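(* Every (randomized or deterministic) strong-probe local computation algorithm for weak $3$-coloring of the $n$-vertex cycle graph requires $\Omega(\log^* n)$ probes.
   Context: The input graph $G=(V,E)$ has $n$ vertices with distinct IDs. A strong probe specifies a vertex $v$ and returns the list of all neighbors of $v$. A deterministic local computation algorithm (LCA) receives a query vertex $v$, makes probes, and returns a color for $v$; the answers to all queries must together form a single valid solution. A randomized LCA may additionally read a random seed chosen before the input is given, and otherwise behaves like a deterministic LCA; it uses $p(n)$ probes with failure probability $\delta(n)$ if the probability (over the seed) that some query uses more than $p(n)$ probes is at most $\delta(n)$. A weak $c$-coloring is a map $col:V\to\{1,\dots,c\}$ such that every non-isolated vertex has a neighbor with a different color. *)

(* Defs.v *)
From HB Require Import structures.
From mathcomp Require Import all_boot all_order all_algebra.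
From mathcomp Require Import all_classical all_reals all_analysis.

Set Implicit Arguments.
Unset Strict Implicit.
Unset Printing Implicit Defensive.

Import Order.TTheory GRing.Theory Num.Theory.
Import numFieldNormedType.Exports.

Local Open Scope classical_set_scope.
Local Open Scope ring_scope.

Record id_graph (n N : nat) := IdGraph {
  adj : rel 'I_n;
  adj_sym : symmetric adj;
  adj_irr : irreflexive adj;
  vid : 'I_n -> nat;
  vid_lt : forall v, (vid v < N)%N;
  vid_inj : injective vid
}.

Definition is_cycle_graph (n N : nat) (G : id_graph n N) : Prop :=
  (3 <= n)%N /\
  exists2 f : 'I_n -> 'I_n, bijective f &
    forall i j, adj G (f i) (f j) = (j == ordS i) || (i == ordS j).

Definition weak_coloring (n N c : nat) (G : id_graph n N) (col : 'I_n -> 'I_c) : Prop :=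
  forall v, (exists u, adj G v u) -> exists2 u, adj G v u & col u <> col v.

(* The neighbors are listed by increasing ID, so that the order of the list
   carries no information; None is the answer for an ID that no vertex bears. *)
Definition strong_probe (n N : nat) (G : id_graph n N) (x : nat) : option (seq nat) :=
  if [pick v | vid G v == x] is Some v
  then Some (sort leq [seq vid G u | u <- enum (adj G v)])
  else None.

(* The adaptive computation performed on one query. Any ID may be probed, not
   only those already discovered; every branch is finite. *)
Inductive probe_tree (c : nat) : Type :=
| Return of 'I_c
| Probe of nat & (option (seq nat) -> probe_tree c).

Fixpoint result (c : nat) (oracle : nat -> option (seq nat)) (t : probe_tree c) : 'I_c :=
  match t with
  | Return a => a
  | Probe x k => result oracle (k (oracle x))
  end.

Fixpoint nprobes (c : nat) (oracle : nat -> option (seq nat)) (t : probe_tree c) : nat :=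
  match t with
  | Return _ => 0
  | Probe x k => (nprobes oracle (k (oracle x))).+1
  end.

(* A deterministic LCA for a given number of vertices (and a given ID range):
   it maps the ID of the queried vertex to a computation. *)
Definition lca (c : nat) := nat -> probe_tree c.

Definition answer (n N c : nat) (A : lca c) (G : id_graph n N) (v : 'I_n) : 'I_c :=
  result (strong_probe G) (A (vid G v)).

Definition query_probes (n N c : nat) (A : lca c) (G : id_graph n N) (v : 'I_n) : nat :=
  nprobes (strong_probe G) (A (vid G v)).

Definition weak_colors_cycles (n N c : nat) (A : lca c) : Prop :=
  forall G : id_graph n N, is_cycle_graph G -> weak_coloring G (answer A G).

Definition uses_probes (n N c : nat) (A : lca c) (p : nat) : Prop :=
  forall G : id_graph n N, is_cycle_graph G -> forall v, (query_probes A G v <= p)%N.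

Section Randomized.
Context {d : measure_display} {T : measurableType d} {R : realType}.

(* The input is quantified before the seed is drawn. *)
Definition uses_probes_with_failure (n N c : nat) (P : probability T R)
    (A : T -> lca c) (p : nat) (delta : R) : Prop :=
  forall G : id_graph n N, is_cycle_graph G ->
    let F := [set s | exists v, (p < query_probes (A s) G v)%N] in
    measurable F /\ (P F <= delta%:E)%E.

End Randomized.

Section LogStar.
Context (R : realType).

Definition log2 (x : R) : R := ln x / ln 2.

Lemma iter_log2_le1 (k : nat) (x : R) :
  x <= (iter k (expn 2) 1)%:R -> iter k log2 x <= 1.
Proof.
have l2 : 0 < ln (2 : R) by rewrite ln_gt0// ltr1n.
elim: k x => [//|k IH] x; rewrite iterS iterSr => xle; apply: IH.
rewrite /log2 ler_pdivrMr//; have [x0|x0] := leP x 0.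
  by apply: (@le_trans _ _ 0); [apply: ln_le0; rewrite (le_trans x0)|
    rewrite mulr_ge0// ltW].
rewrite mulr_natl -lnXn ?ltr0n// ler_ln ?posrE// ?exprn_gt0//.
by rewrite -natrX.
Qed.

Lemma log_star_subproof (n : nat) : exists k, iter k log2 n%:R <= 1.
Proof.
exists n; apply: iter_log2_le1; rewrite ler_nat.
by elim: n => // n IH; rewrite iterS (leq_ltn_trans IH)// ltn_expl.
Qed.

Definition log_star (n : nat) : nat := ex_minn (log_star_subproof n).

End LogStar.

(* Main.v *)
Require Import Defs.
From HB Require Import structures.
From mathcomp Require Import all_boot all_order all_algebra.
From mathcomp Require Import all_classical all_reals all_analysis.
From mathcomp Require Import measurable_realfun zify ring lra.

(* A run of p probes is played against a cycle in which L blocks of K = 2p+3 random IDs are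
   spliced into the cyclic order 0, 1, ..., n-1. Giving away, at time t, all the IDs within
   distance t of the queried vertex, every other probe misses the random IDs with overwhelming
   probability, so its answer carries no information and the color of the middle vertex of a
   window of 2p+1 IDs is a function of that window. Such a function yields, on increasing
   windows, a coloring of a shift graph; since discarding the last coordinate of a proper
   c-coloring costs one exponential, out of more than tower(2p+1, 6) IDs one can always pick a
   block whose three central vertices get the same color. Hence a random block is bad with a
   probability that does not depend on n, and with enough independent blocks an algorithm
   that is always correct exceeds p probes on all but an arbitrarily small fraction of these
   cycles, as soon as n is a bounded number of exponentials above tower(2p, 1). Averaging
   over the seed then covers randomized algorithms. *)

Set Implicit Arguments.
Unset Strict Implicit.
Unset Printing Implicit Defensive.

(** * Colorings of shift graphs *)

Definition tower (k c : nat) := iter k (expn 2) c.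

Section Shift.
Variable m : nat.
Local Notation ltm := (fun x y : 'I_m => x < y).

(** Induction on [k]: a shorter sequence is colored by the set of colors of its one-point
    extensions, which costs one exponential. If [take k.+1 s] and [behead s] get the same set, the
    color of [s] is also that of some increasing extension of [behead s]. *)
Lemma shift_coloring (k : nat) (C : finType) (F : seq 'I_m -> C) :
  tower k #|C| < m ->
  exists2 s, sorted ltm s && (size s == k.+2) & F (take k.+1 s) = F (behead s).
Proof.
elim: k C F => [|k IH] C F /=.
  move=> lt.
  have /injectivePn [x [y xy eqF]]: ~~ injectiveb (fun x => F [:: x]).
    apply/negP => /injectiveP /leq_card; rewrite card_ord => le.
    by move: lt; rewrite ltnNge le.
  wlog lxy : x y xy eqF / x < y.
    move=> H; case: (ltngtP x y) => [l|l|/val_inj e]; first exact: (H x y).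
      by apply: (H y x) => //; rewrite eq_sym.
    by rewrite e eqxx in xy.
  by exists [:: x; y]; rewrite /= ?lxy.
rewrite -/(tower k _) => lt.
pose G s := [set a | [exists y, sorted ltm (rcons s y) && (F (rcons s y) == a)]].
have := IH {set C} G; rewrite -cardsT -powersetT card_powerset cardsT.
have -> : tower k (2 ^ #|C|) = 2 ^ tower k #|C| by rewrite /tower -iterSr.
case/(_ lt) => s /andP[ss /eqP sz] eqG.
have : F s \in G (take k.+1 s).
  case/lastP: s ss sz eqG => // s z ss; rewrite size_rcons => -[sz] _.
  rewrite -{2}cats1 -sz take_size_cat // inE; apply/existsP; exists z.
  by rewrite ss eqxx.
rewrite eqG inE => /existsP[y /andP[sy /eqP eF]].
case: s ss sz eqG sy eF => // x s ss [sz] _ /= sy eF.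
exists (rcons (x :: s) y).
  rewrite size_rcons /= sz eqxx andbT.
  case: s ss sz sy {eF} => //= z s /andP[-> _] _ /= -> //.
rewrite -cats1 take_size_cat /= ?sz //.
by rewrite cats1 eF.
Qed.

Lemma shift_run3 (k : nat) (C : finType) (F : seq 'I_m -> C) :
  tower k.+1 (#|C| * 2) < m ->
  exists2 s, sorted ltm s && (size s == k.+3) &
    F (take k.+1 s) = F (take k.+1 (behead s)) /\
    F (take k.+1 (behead s)) = F (behead (behead s)).
Proof.
(* If no three consecutive colors agree, the bit tells apart two equal consecutive ones. *)
pose F' s := (F (take k.+1 s), F (take k.+1 s) == F (behead s)).
have := @shift_coloring k.+1 (C * bool)%type F'.
rewrite card_prod card_bool => H /H [s /andP[ss /eqP sz] [e1 e2]].
have szb : size (behead s) = k.+2 by rewrite size_behead sz.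
exists s; first by rewrite ss sz eqxx.
rewrite take_takel // in e1 e2.
have tb : behead (take k.+2 s) = take k.+1 (behead s) by case: (s).
rewrite tb e1 eqxx in e2.
by split => //; apply/eqP; rewrite -e2.
Qed.
End Shift.

(** * Uniform random functions, handled by counting *)

Section Resample.
Variables (I J X : finType) (h : J -> I).
Implicit Types (f : {ffun I -> X}) (w : {ffun J -> X}).

Definition pullback f : {ffun J -> X} := [ffun j => f (h j)].
Definition resample f w : {ffun I -> X} :=
  [ffun i => if [pick j | h j == i] is Some j then w j else f i].

Lemma resample_off f w i : (forall j, h j != i) -> resample f w i = f i.
Proof. by move=> H; rewrite ffunE; case: pickP => // j; rewrite (negbTE (H j)). Qed.

Hypothesis h_inj : injective h.

Lemma resample_on f w j : resample f w (h j) = w j.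
Proof.
by rewrite ffunE; case: pickP => [j' /eqP/h_inj-> //|/(_ j)]; rewrite eqxx.
Qed.

Lemma pullback_resample f w : pullback (resample f w) = w.
Proof. by apply/ffunP=> j; rewrite ffunE resample_on. Qed.

Lemma resampleK f w : resample (resample f w) (pullback f) = f.
Proof.
apply/ffunP=> i; case: (pickP [pred j | h j == i]) => [j /eqP <-|H].
  by rewrite resample_on ffunE.
by rewrite !resample_off // => j; rewrite [_ == _]H.
Qed.

Lemma card_resample (P : pred {ffun I -> X}) :
  #|P| * #|{ffun J -> X}| = \sum_f #|[pred w | P (resample f w)]|.
Proof.
(* Exchanging the values on the image of [h] with [w] is an involution. *)
pose tau (fw : {ffun I -> X} * {ffun J -> X}) := (resample fw.1 fw.2, pullback fw.1).
have tauK : involutive tau by case=> f w; rewrite /tau /= resampleK pullback_resample.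
under eq_bigr => f _ do rewrite -sum1_card big_mkcond /=.
rewrite pair_bigA /= (reindex_inj (inv_inj tauK)) /=.
under eq_bigr => fw _ do rewrite inE /= resampleK.
rewrite -(pair_bigA _ (fun f (w : {ffun J -> X}) => if P f then 1 else 0)) /=.
under eq_bigr => f _ do rewrite sum_nat_const.
by rewrite -big_distrr /= mulnC -big_mkcond sum1_card.
Qed.

(** The restriction of a uniform random function along an injection is uniform. *)
Lemma card_pullback (V : pred {ffun J -> X}) :
  #|[pred f | V (pullback f)]| * #|{ffun J -> X}| = #|V| * #|{ffun I -> X}|.
Proof.
rewrite card_resample; under eq_bigr => f _.
  rewrite (eq_card (B := V)); first by over.
  by move=> w; rewrite !inE pullback_resample.
by rewrite sum_nat_const mulnC.
Qed.
End Resample.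

(** The guess [g f] is fixed once the coordinates other than [i0] are, and then at most [b] values
    of [f i0] lie near it. *)
Lemma card_coord_near (I X : finType) (i0 : I) (g : {ffun I -> X} -> option X)
    (near : X -> seq X) (b : nat) :
  (forall x, size (near x) <= b) ->
  (forall f f' : {ffun I -> X}, (forall i, i != i0 -> f i = f' i) -> g f = g f') ->
  #|[pred f : {ffun I -> X} | if g f is Some y then f i0 \in near y else false]| * #|X|
    <= b * #|{ffun I -> X}|.
Proof.
move=> near_b g_ext; pose h (_ : unit) := i0.
have h_inj : injective h by case; case.
have := card_resample h_inj [pred f : {ffun I -> X} |
  if g f is Some y then f i0 \in near y else false].
rewrite card_ffun card_unit expn1 => ->.
rewrite mulnC -sum_nat_const leq_sum // => f _.
have gE w : g (resample h f w) = g f.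
  by apply: g_ext => i ii0; apply: resample_off => j; rewrite eq_sym.
case E: (g f) => [y|]; last by rewrite eq_card0 // => w; rewrite !inE gE E.
apply: (leq_trans _ (near_b y)); apply: leq_trans (card_size _).
rewrite -(fintype.card_in_image (f := fun w : {ffun unit -> X} => w tt)).
  apply/subset_leq_card/fintype.subsetP => x /fintype.imageP[w]; rewrite !inE gE E.
  by rewrite (_ : i0 = h tt) // resample_on // => ? ->.
by move=> w w' _ _ e; apply/ffunP; case.
Qed.

(** * Cycle graphs built from cyclic orders of the IDs *)

Lemma next_adjacent (T : eqType) (a b : seq T) (x y : T) :
  uniq (a ++ x :: y :: b) -> next (a ++ x :: y :: b) x = y.
Proof.
by move=> /cycle_next; rewrite -(rot_cycle (size a)) rot_size_cat /= => /andP[/eqP].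
Qed.

Lemma next_nth_ordS n (x0 : 'I_n) (s : seq 'I_n) (i : 'I_n) : uniq s -> size s = n ->
  next s (nth x0 s i) = nth x0 s (ordS i).
Proof.
move=> us sz; have is_ : i < size s by rewrite sz.
rewrite next_nth mem_nth // index_uniq //; case: s us sz is_ => // y s us sz is_.
rewrite /=; have [lt|ge] := ltnP i.+1 n.
  by rewrite modn_small //= (set_nth_default x0) // -ltnS -[(size s).+1]/(size (y :: s)) sz.
have -> : i.+1 = n by apply/eqP; rewrite eqn_leq ge andbT.
by rewrite modnn /= nth_default // -ltnS -[(size s).+1]/(size (y :: s)) sz.
Qed.

Definition seq_adj n (s : seq 'I_n) : rel 'I_n :=
  fun u v => (v == next s u) || (u == next s v).

Lemma seq_adjE n (s : seq 'I_n) u : uniq s -> seq_adj s u =i [:: next s u; prev s u].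
Proof.
move=> us v; rewrite !inE /in_mem /= /seq_adj; congr (_ || _).
by apply/eqP/eqP => ->; rewrite ?prev_next ?next_prev.
Qed.

(** Vertices serve as their own IDs, so that a graph is just a cyclic order of [0, ..., n-1] and a
    probe of a larger ID returns [None]. *)
Lemma cycle_graph_of_seq n N (s : seq 'I_n) :
  n <= N -> 3 <= n -> uniq s -> (forall x, x \in s) ->
  exists G : id_graph n N, [/\ is_cycle_graph G, forall v, vid G v = v &
    forall u, adj G u =i [:: next s u; prev s u]].
Proof.
move=> nN n3 us sall.
have sz : size s = n.
  by rewrite -(card_uniqP us) -[RHS]card_ord; apply: eq_card => x; rewrite sall.
have x0 : 'I_n by apply: (@Ordinal _ 0); lia.
pose f (i : 'I_n) := nth x0 s i.
have f_inj : injective f.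
  by move=> i j /eqP; rewrite /f nth_uniq ?sz // => /eqP /val_inj.
have f_bij : bijective f by apply: injF_bij.
have adjf i j : seq_adj s (f i) (f j) = (j == ordS i) || (i == ordS j).
  by rewrite /seq_adj /f !next_nth_ordS // -!/(f _) !(inj_eq f_inj).
have sym : symmetric (seq_adj s) by move=> u v; rewrite /seq_adj orbC.
have irr : irreflexive (seq_adj s).
  have [g fK gK] := f_bij.
  move=> u; rewrite -(gK u) adjf orbb; apply/negbTE/eqP => /(congr1 val) /=.
  have := ltn_ord (g u); case: (ltnP (g u).+1 n) => [lt _|ge lt].
    by rewrite modn_small //; lia.
  have -> : (g u).+1 = n by lia.
  by rewrite modnn; lia.
have vlt (v : 'I_n) : val v < N by apply: leq_trans (ltn_ord v) nN.
exists (IdGraph sym irr vlt val_inj); split => //.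
  by split => //; exists f => // i j; rewrite adjf.
by move=> u v; rewrite -seq_adjE.
Qed.

Definition probe_answer n (us : seq 'I_n) : option (seq nat) :=
  Some (sort leq [seq val u | u <- enum us]).

Lemma strong_probe_vid n N (G : id_graph n N) (v : 'I_n) (us : seq 'I_n) :
  (forall v, vid G v = v) -> adj G v =i us -> strong_probe G v = probe_answer us.
Proof.
move=> vidE adjE; rewrite /strong_probe; case: pickP => [w|/(_ v)]; last by rewrite vidE eqxx.
rewrite vidE => /eqP/val_inj ->; congr (Some (sort _ _)).
by rewrite (eq_map (vidE)) (eq_enum adjE).
Qed.

Lemma strong_probe_out n N (G : id_graph n N) y :
  (forall v, vid G v = v) -> n <= y -> strong_probe G y = None.
Proof.
move=> vidE ny; rewrite /strong_probe; case: pickP => // v; rewrite vidE => /eqP e.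
by have := ltn_ord v; rewrite e ltnNge ny.
Qed.

(* [x0 :: l] is spliced into the cyclic order 0, 1, ..., n-1 in the place of [x0], so that the
   neighbors of its two ends can only be guessed by guessing [x0]; the labels in [l] are
   removed from that order. *)
Section Splice.
Variables (n : nat) (x0 : 'I_n) (l t : seq 'I_n).
Hypothesis cyc_t : fcycle (@ordS n) (x0 :: t).
Hypothesis uniq_t : uniq (x0 :: t).
Hypothesis all_t : forall x, x \in x0 :: t.
Hypothesis uniq_l : uniq (x0 :: l).

Let s := (x0 :: l) ++ [seq y <- t | y \notin x0 :: l].

Lemma splice_uniq : uniq s.
Proof.
rewrite cat_uniq uniq_l filter_uniq ?andbT /=; last by case/andP: uniq_t.
by apply/hasPn => y; rewrite mem_filter => /andP[].
Qed.

Lemma splice_all x : x \in s.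
Proof.
rewrite mem_cat mem_filter; case: (boolP (x \in x0 :: l)) => //= xl.
by move: (all_t x) xl; rewrite !inE => /orP[->|->]; rewrite ?orbT.
Qed.

Lemma splice_next_line d i : i.+1 < size (x0 :: l) ->
  next s (nth d (x0 :: l) i) = nth d (x0 :: l) i.+1.
Proof.
move=> lt; have := splice_uniq; rewrite /s.
rewrite -[X in uniq (X ++ _)](cat_take_drop i) -[X in next (X ++ _)](cat_take_drop i).
rewrite (drop_nth d (ltnW lt)) (drop_nth d lt) -!catA !cat_cons.
exact: next_adjacent.
Qed.

Lemma cyc_split y : y \in t -> ordS y != x0 ->
  exists a b, t = a ++ y :: ordS y :: b.
Proof.
move=> /splitPr yt; case: yt cyc_t => a [|z b] /=.
  rewrite rcons_cat cat_path /= => /and3P[_ _ /andP[/eqP <-]].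
  by rewrite eqxx.
by rewrite rcons_cat cat_path /= => /and4P[_ _ /eqP <- _] _; exists a, b.
Qed.

Lemma splice_next_out y : y \notin x0 :: l -> ordS y \notin x0 :: l -> next s y = ordS y.
Proof.
move=> yl Syl; have yt : y \in t.
  by move: yl; have := all_t y; rewrite !inE; case: eqP.
have Sy0 : ordS y != x0 by apply: contraNneq Syl => ->; rewrite mem_head.
have [a [b te]] := cyc_split yt Sy0.
have := splice_uniq; rewrite /s.
have -> : [seq z <- t | z \notin x0 :: l] = [seq z <- a | z \notin x0 :: l] ++
    y :: ordS y :: [seq z <- b | z \notin x0 :: l].
  by rewrite te filter_cat /= yl Syl.
rewrite catA; exact: next_adjacent.
Qed.

(** The label [ordS y] was moved away and the order closes over the gap. It has to lie in [l]: [x0]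
    keeps its place and would still follow [y]. *)
Lemma splice_next_skip y : y \notin x0 :: l -> ordS y \in l -> ordS (ordS y) \notin x0 :: l ->
  next s y = ordS (ordS y).
Proof.
move=> yl Syl SSyl; have yt : y \in t.
  by move: yl; have := all_t y; rewrite !inE; case: eqP.
have Sy0 : ordS y != x0.
  by apply: contraTneq Syl => ->; case/andP: uniq_l.
have SSy0 : ordS (ordS y) != x0 by apply: contraNneq SSyl => ->; rewrite mem_head.
have [a [b te]] := cyc_split yt Sy0.
have [b'' be] : exists b'', b = ordS (ordS y) :: b''.
  have := cyc_t; rewrite te /=; case: b {te} => [|z b''].
    rewrite rcons_cat cat_path /= => /and5P[_ _ _ /eqP e _].
    by rewrite e eqxx in SSy0.
  by rewrite rcons_cat cat_path /= => /and5P[_ _ _ /eqP <- _]; exists b''.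
have := splice_uniq; rewrite /s.
have -> : [seq z <- t | z \notin x0 :: l] = [seq z <- a | z \notin x0 :: l] ++
    y :: ordS (ordS y) :: [seq z <- b'' | z \notin x0 :: l].
  by rewrite te be filter_cat /= yl SSyl inE Syl orbT.
rewrite catA; exact: next_adjacent.
Qed.
End Splice.

(** One jump is enough when [K] contains no two consecutive IDs, as [splices] assumes and the
    exclusion of [collide] will ensure. *)
Definition skip n (K : seq 'I_n) (f : 'I_n -> 'I_n) (y : 'I_n) : 'I_n :=
  if f y \in K then f (f y) else f y.

Definition near2 n (y : 'I_n) : seq 'I_n :=
  [:: y; ordS y; ordS (ordS y); ord_pred y; ord_pred (ord_pred y)].

Lemma fcycle_ordS n (x : 'I_n) : exists t : seq 'I_n,
  [/\ fcycle (@ordS n) (x :: t), uniq (x :: t) & forall y, y \in x :: t].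
Proof.
have us := enum_uniq 'I_n.
have cyc : fcycle (@ordS n) (enum 'I_n).
  apply: cycle_from_next => // y _; apply/eqP; symmetry.
  have := next_nth_ordS x y us (size_enum_ord n).
  by rewrite !nth_ord_enum.
have [i t e] := rot_to (mem_enum 'I_n x).
exists t; rewrite -e rot_cycle rot_uniq; split => // y.
by rewrite mem_rot mem_enum.
Qed.

(* [G] looks like [l] at the interior of [l], and like the cyclic order of the IDs far from [l];
   an observer who knows only the part [K] of [l] can predict the neighbors of any [y]
   that has no unknown label of [l] within distance 2. *)
Definition splices n N (l : seq 'I_n) (G : id_graph n N) :=
  [/\ forall v, vid G v = v,
    forall d i, 0 < i -> i.+1 < size l -> adj G (nth d l i) =i [:: nth d l i.+1; nth d l i.-1] &
    forall (K : seq 'I_n) y, {subset K <= behead l} -> {in K, forall z, ordS z \notin K} ->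
      {in near2 y, forall z, z \in l -> z \in K} -> y \notin K ->
      adj G y =i [:: skip K (@ordS n) y; skip K (@ord_pred n) y]].

Lemma spliced_cycle n N (l : seq 'I_n) : n <= N -> 3 <= n -> uniq l -> 0 < size l ->
  exists2 G : id_graph n N, is_cycle_graph G & splices l G.
Proof.
move=> nN n3; case: l => // x0 l ul _.
have [t [ct ut at_]] := fcycle_ordS x0.
have us := splice_uniq ut ul; have as_ := splice_all l at_.
have [G [Gc Gv Ga]] := cycle_graph_of_seq nN n3 us as_.
exists G => //; split=> //.
  move=> d [//|i] _ lt v; rewrite Ga !inE.
  rewrite (splice_next_line ut ul d lt) -pred_Sn.
  by rewrite -(splice_next_line ut ul d (ltnW lt)) (prev_next us).
move=> K y sK spK nearK yK v; rewrite Ga.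
have inK z : z \in near2 y -> z \notin K -> z \notin x0 :: l.
  by move=> zn; apply: contra; apply: nearK.
have yl : y \notin x0 :: l by apply: inK => //; rewrite !inE eqxx.
have -> : next ((x0 :: l) ++ [seq y <- t | y \notin x0 :: l]) y = skip K (@ordS n) y.
  rewrite /skip; case: ifPn => Sy.
    apply: splice_next_skip => //; first exact: sK.
    by apply: inK; [rewrite !inE eqxx !orbT | apply: spK].
  by apply: splice_next_out => //; apply: inK => //; rewrite !inE eqxx !orbT.
suff -> : prev ((x0 :: l) ++ [seq y <- t | y \notin x0 :: l]) y = skip K (@ord_pred n) y by [].
(* The predecessor is handled by the lemmas on successors: it suffices that the successor of
   [skip K (@ord_pred n) y] is [y]. *)
rewrite -[RHS](prev_next us); congr prev; symmetry.
rewrite /skip; case: ifPn => Py.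
  have PPy : ord_pred (ord_pred y) \notin x0 :: l.
    apply: inK; first by rewrite !inE eqxx !orbT.
    by apply/negP => /spK; rewrite ord_predK Py.
  by rewrite (splice_next_skip ct) ?ord_predK //; apply: sK.
have Pyl : ord_pred y \notin x0 :: l by apply: inK => //; rewrite !inE eqxx !orbT.
by rewrite (splice_next_out ct) ?ord_predK.
Qed.

(** * Simulation of a query without the graph *)

Section StepOracle.
Variable k : nat.
Implicit Types (o : nat -> nat -> option (seq nat)) (tr : probe_tree k).

(* [o r] answers the probe made at time [r]; [step_probe o r t tr] is the probe made at
   time [r + t] when [tr] is started at time [r]. *)
Fixpoint step_probe o r t tr : option nat :=
  match tr with
  | Return _ => None
  | Probe y f => if t is t'.+1 then step_probe o r.+1 t' (f (o r y)) else Some y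
  end.

(** [a0] is a default color, for trees that need more than [t] probes. *)
Fixpoint step_result (a0 : 'I_k) o r t tr : 'I_k :=
  match tr with
  | Return a => a
  | Probe y f => if t is t'.+1 then step_result a0 o r.+1 t' (f (o r y)) else a0
  end.

Lemma step_probe_ext o o' r t tr : (forall i, r <= i < r + t -> o i =1 o' i) ->
  step_probe o r t tr = step_probe o' r t tr.
Proof.
elim: t r tr => [|t IH] r [a|y f] //= e.
rewrite e; last by lia.
by apply: IH => i ir; apply: e; lia.
Qed.

Lemma step_result_ext a0 o o' r t tr : (forall i, r <= i < r + t -> o i =1 o' i) ->
  step_result a0 o r t tr = step_result a0 o' r t tr.
Proof.
elim: t r tr => [|t IH] r [a|y f] //= e.
rewrite e; last by lia.
by apply: IH => i ir; apply: e; lia.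
Qed.

(** The oracles have to agree only at the probes that the simulated run makes: by induction the real
    run makes the same ones. *)
Lemma result_step a0 o orc r t tr : nprobes orc tr <= t ->
  (forall i y, i < t -> step_probe o r i tr = Some y -> orc y = o (r + i) y) ->
  result orc tr = step_result a0 o r t tr.
Proof.
elim: t r tr => [|t IH] r [a|y f] //= le e.
have e0 : orc y = o r y by rewrite -[r in o r]addn0; apply: e.
rewrite -e0; apply: IH => // i z it; rewrite addSnnS => sp.
by apply: e => //=; rewrite -e0.
Qed.
End StepOracle.

Section Simulation.
Variables (n p : nat).
Implicit Types (u : nat -> 'I_n).

(* The window [u] is centered at [p]; this is what is given away at time [r]. *)
Definition known u r : seq 'I_n := [seq u d | d <- iota (p - r) r.*2.+1].

(** At a known label the answer is read in the window. Any other label is presumed to be at distance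
    more than 2 from the labels still unknown, so that its neighbors follow the order of the IDs
    with the known labels taken out. *)
Definition sim_answer u r (y : nat) : option (seq nat) :=
  if insub y is Some y' then
    if y' \in known u r then
      let d := p - r + index y' (known u r) in probe_answer [:: u d.+1; u d.-1]
    else probe_answer [:: skip (known u r) (@ordS n) y'; skip (known u r) (@ord_pred n) y']
  else None.

Lemma known_ext u u' r : r <= p -> (forall d, p - r <= d <= p + r -> u d = u' d) ->
  known u r = known u' r.
Proof.
by move=> rp e; apply/eq_in_map => d; rewrite mem_iota => dr; apply: e; lia.
Qed.

Lemma sim_answer_ext u u' r : r < p -> (forall d, p - r.+1 <= d <= p + r.+1 -> u d = u' d) ->
  sim_answer u r =1 sim_answer u' r.
Proof.
move=> rp e y; rewrite /sim_answer; case: insubP => // y' _ _.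
have <- : known u r = known u' r by apply: known_ext => [|d dr]; [lia | apply: e; lia].
case: ifP => //; rewrite -index_mem size_map size_iota => lt.
by rewrite !e //; lia.
Qed.

Variables (k : nat) (A : lca k.+1).

Definition sim_probe u t : option nat := step_probe (sim_answer u) 0 t (A (u p)).

(** An answer at time [r] reads positions within [r + 1] of the center, so the answers received
    before time [t] depend on positions within [t]. *)
Lemma sim_probe_ext u u' t : t <= p -> (forall d, p - t <= d <= p + t -> u d = u' d) ->
  sim_probe u t = sim_probe u' t.
Proof.
move=> tp e; rewrite /sim_probe e; last lia.
by apply: step_probe_ext => i it; apply: sim_answer_ext => [|d dr]; [lia | apply: e; lia].
Qed.

Definition sim_color u : 'I_k.+1 := step_result ord0 (sim_answer u) 0 p (A (u p)).

Lemma sim_color_ext u u' : (forall d, d <= p.*2 -> u d = u' d) -> sim_color u = sim_color u'.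
Proof.
move=> e; rewrite /sim_color e; last lia.
by apply: step_result_ext => i it; apply: sim_answer_ext => [|d dr]; [lia | apply: e; lia].
Qed.
End Simulation.

(** * Random labels and the probability of a lucky guess *)

Section Configuration.
Variables (n p M : nat) (x0 : 'I_n).
Implicit Types (c : {ffun 'I_M -> 'I_n}).

Definition label c i : 'I_n := nth x0 (codom c) i.

Lemma labelE c (i : 'I_M) : label c i = c i.
Proof. by rewrite /label codomE (nth_map i) ?nth_ord_enum ?size_enum_ord. Qed.

Lemma labelP c i (lt : i < M) : label c i = c (Ordinal lt).
Proof. by rewrite -labelE. Qed.

Definition sight c b d : 'I_n := label c (b + d).

Variable A : lca 3.

(* A hit is a lucky guess: the label [c i0] is not known at time [t], so that the probe made
   at that time does not depend on it. *)
Definition hit (c : {ffun 'I_M -> 'I_n}) (b t : nat) (i0 : 'I_M) :=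
  ~~ (b + p - t <= i0 <= b + p + t) &&
  if obind insub (sim_probe p A (sight c b) t) is Some y then c i0 \in near2 y else false.

(** Without collisions the labels are distinct and no two are consecutive, so that they can be
    spliced and [skip] is accurate. *)
Definition collide (c : {ffun 'I_M -> 'I_n}) (i i0 : 'I_M) :=
  (i0 != i) && (c i0 \in near2 (c i)).

Definition good c :=
  [forall b : 'I_M, forall t : 'I_p, forall i0, ~~ hit c b t i0] &&
  [forall i, forall i0, ~~ collide c i i0].

(** By [sim_probe_ext] the probe at time [t] does not depend on [c i0] when [i0] is out of range.
    The constant 5 is the length of [near2]. *)
Lemma card_hit (b : nat) (t : 'I_p) i0 :
  #|[pred c | hit c b t i0]| * n <= 5 * n ^ M.
Proof.
have [inr|outr] := boolP (b + p - t <= i0 <= b + p + t).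
  by rewrite eq_card0 // => c; rewrite !inE /hit inr.
have := @card_coord_near 'I_M 'I_n i0
  (fun c => obind insub (sim_probe p A (sight c b) t)) (@near2 n) 5.
rewrite card_ffun !card_ord => H; apply: leq_trans (H _ _) => //.
  rewrite leq_mul //; apply/subset_leq_card/fintype.subsetP => c.
  by rewrite inE => /andP[_].
move=> f f' e; congr obind; apply: sim_probe_ext => [|d dr]; first exact: ltnW.
rewrite /sight; have [lt|ge] := ltnP (b + d) M; last first.
  by rewrite /label !nth_default // size_codom card_ord.
rewrite !labelP; apply: e; apply: contraNneq outr => <- /=; have := ltn_ord t; lia.
Qed.

Lemma card_collide (i i0 : 'I_M) : #|[pred c | collide c i i0]| * n <= 5 * n ^ M.
Proof.
have [ii0|ii0] := eqVneq i0 i.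
  by rewrite eq_card0 // => c; rewrite !inE /collide ii0 eqxx.
have := @card_coord_near 'I_M 'I_n i0
  (fun c => Some (c i)) (@near2 n) 5.
rewrite card_ffun !card_ord => H; apply: leq_trans (H _ _) => //.
  rewrite leq_mul //; apply/subset_leq_card/fintype.subsetP => c.
  by rewrite inE => /andP[_].
by move=> f f' e; congr Some; apply: e; rewrite eq_sym.
Qed.

(** Union bound over [M * p * M] possible hits and [M * M] possible collisions. *)
Lemma card_not_good : #|[pred c | ~~ good c]| * n <= 5 * (M * M * p.+1) * n ^ M.
Proof.
have sub : #|[pred c | ~~ good c]| <=
    \sum_(b < M) \sum_(t < p) \sum_(i0 < M) #|[pred c | hit c b t i0]| +
    \sum_(i < M) \sum_(i0 < M) #|[pred c | collide c i i0]|.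
  have cardE (Q : pred {ffun 'I_M -> 'I_n}) : #|[pred c | Q c]| = \sum_c (Q c : nat).
    by rewrite -sum1_card big_mkcond /=; apply: eq_bigr => c _; rewrite inE; case: (Q c).
  rewrite cardE.
  have -> : \sum_(b < M) \sum_(t < p) \sum_(i0 < M) #|[pred c | hit c b t i0]| =
     \sum_c \sum_(b < M) \sum_(t < p) \sum_(i0 < M) (hit c b t i0 : nat).
    rewrite [RHS]exchange_big; apply: eq_bigr => b _.
    rewrite [RHS]exchange_big; apply: eq_bigr => t _.
    by rewrite [RHS]exchange_big; apply: eq_bigr => i0 _; rewrite cardE.
  have -> : \sum_(i < M) \sum_(i0 < M) #|[pred c | collide c i i0]| =
     \sum_c \sum_(i < M) \sum_(i0 < M) (collide c i i0 : nat).
    rewrite [RHS]exchange_big; apply: eq_bigr => b _.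
    by rewrite [RHS]exchange_big; apply: eq_bigr => i0 _; rewrite cardE.
  rewrite -big_split /=; apply: leq_sum => c _.
  case: (boolP (good c)) => //=; rewrite /good negb_and => /orP[].
    rewrite negb_forall => /existsP[b]; rewrite negb_forall => /existsP[t].
    rewrite negb_forall => /existsP[i0]; rewrite negbK => h.
    by rewrite (bigD1 b) //= (bigD1 t) //= (bigD1 i0) //= h; lia.
  rewrite negb_forall => /existsP[i]; rewrite negb_forall => /existsP[i0]; rewrite negbK => h.
  by apply: leq_trans (leq_addl _ _); rewrite (bigD1 i) //= (bigD1 i0) //= h; lia.
apply: (leq_trans (leq_mul sub (leqnn n))).
rewrite mulnDl !big_distrl /=.
apply: (@leq_trans (\sum_(b < M) \sum_(t < p) \sum_(i0 < M) 5 * n ^ M +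
  \sum_(i < M) \sum_(i0 < M) 5 * n ^ M)).
  apply: leq_add; apply: leq_sum => b _; rewrite big_distrl /=; apply: leq_sum => t _.
    by rewrite big_distrl /=; apply: leq_sum => i0 _; apply: card_hit.
  exact: card_collide.
by rewrite !sum_nat_const !card_ord; apply/eq_leq; ring.
Qed.

Lemma good_inj c : good c -> injective c.
Proof.
move=> /andP[_ /forallP H] i j e; apply/eqP; apply: contraT => ij.
by have /forallP/(_ i) := H j; rewrite /collide ij e inE eqxx.
Qed.
End Configuration.

Lemma ordS_neq n (z : 'I_n) : 1 < n -> ordS z != z.
Proof.
move=> n1; apply/eqP => /(congr1 val) /=; have := ltn_ord z.
case: (ltnP z.+1 n) => [lt _|ge lt]; first by rewrite modn_small //; lia.
by have -> : z.+1 = n by [lia]; rewrite modnn; lia.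
Qed.

(** * On good configurations the simulation is faithful *)

Section Good.
Variables (n N p M : nat) (x0 : 'I_n) (A : lca 3) (c : {ffun 'I_M -> 'I_n}).
Variable (G : id_graph n N).
Hypothesis n1 : 1 < n.
Hypothesis spl : splices (codom c) G.
Hypothesis gd : good p x0 A c.

Let szc : size (codom c) = M. Proof. by rewrite size_codom card_ord. Qed.

Lemma mem_codom_label z : z \in codom c -> exists2 i, i < M & z = label x0 c i.
Proof. by move=> /codomP[i ->]; exists i; rewrite ?labelE. Qed.

(** There are three cases: an ID out of range, a known label, whose neighbors are those of the
    spliced sequence, and any other ID, for which the absence of hits is the hypothesis of [splices]
    on [near2]. *)
Lemma good_probe b t y : b + p.*2 < M -> t < p ->
  sim_probe p A (sight x0 c b) t = Some y ->
  strong_probe G y = sim_answer p (sight x0 c b) t y.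
Proof.
move=> bM tp sp; have [vG lG oG] := spl.
rewrite /sim_answer; case: insubP => [y' _ ey|]; last first.
  by rewrite -leqNgt => ny; apply: strong_probe_out.
rewrite -ey; set u := sight x0 c b.
have kn z : z \in known p u t -> exists2 i, b + p - t <= i <= b + p + t & z = label x0 c i.
  by case/mapP => d; rewrite mem_iota => dr ->; exists (b + d) => //; lia.
case: ifPn => yk.
  have := nth_index x0 yk; have := yk; rewrite -index_mem size_map size_iota.
  move: (index _ _) => e lt; rewrite (nth_map 0) ?size_iota // nth_iota //.
  have [d de] : exists d, d = p - t + e by exists (p - t + e).
  rewrite -de => ud; apply: strong_probe_vid => // v.
  rewrite -ud /u /sight /label lG ?szc ?addnS; try lia.
  rewrite !inE; congr (_ || (_ == nth _ _ _)).
  by lia.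
apply: strong_probe_vid => //; apply: oG => //.
(* As [t < p], a known label has a positive position, hence is not the head of the spliced
   sequence. *)
- move=> z /kn [i ir ->]; rewrite /label -[i](@subnKC 1); last by lia.
  by rewrite -nth_drop drop1 mem_nth // size_behead szc; lia.
- move=> z /kn [i ir ->]; apply/negP => /kn[j jr e].
  have lti : i < M by lia.
  have ltj : j < M by lia.
  have [ij|ij] := eqVneq i j.
    by move: (ordS_neq (label x0 c i) n1); rewrite e ij eqxx.
  move: gd => /andP[_ /forallP/(_ (Ordinal lti)) /forallP /(_ (Ordinal ltj))].
  rewrite /collide -!(labelP x0) -e !inE eqxx !orbT andbT negbK.
  by move=> /eqP [ji]; rewrite ji eqxx in ij.
- move=> z zn /mem_codom_label [i iM ze].
  have [ir|ir] := boolP (b + p - t <= i <= b + p + t).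
    apply/mapP; exists (i - b); first by rewrite mem_iota; lia.
    by rewrite /u /sight subnKC //; lia.
  have bM' : b < M by lia.
  move: gd => /andP[/forallP/(_ (Ordinal bM')) /forallP /(_ (Ordinal tp))].
  move=> /forallP /(_ (Ordinal iM)) + _.
  by rewrite /hit /= ir sp -ey /= valK -(labelP x0) -ze zn.
Qed.

Lemma good_answer b : b + p.*2 < M ->
  (query_probes A G (sight x0 c b p) <= p)%N ->
  answer A G (sight x0 c b p) = sim_color p A (sight x0 c b).
Proof.
move=> bM; rewrite /query_probes /answer /sim_color; have [-> _ _] := spl => le.
apply: result_step => // i y ip sp; rewrite add0n.
exact: good_probe.
Qed.
End Good.

(** * The probability that a random block is bad *)

Section Violation.
Variables (n p : nat) (x0 : 'I_n) (A : lca 3).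

Definition window_color (s : seq 'I_n) : 'I_3 := sim_color p A (nth x0 s).

(** On a block of [2p + 3] labels, the three windows are centered at its three central vertices. If
    their colors agree, the middle vertex has no neighbor of another color. *)
Definition violates (s : seq 'I_n) : bool :=
  (window_color (take p.*2.+1 s) == window_color (take p.*2.+1 (drop 1 s))) &&
  (window_color (take p.*2.+1 (drop 1 s)) == window_color (take p.*2.+1 (drop 2 s))).

(** This is [shift_run3] on positions, colored through [f]; the base 6 is 3 colors times the extra
    bit. *)
Lemma violates_exists m (f : 'I_m -> 'I_n) : tower p.*2.+1 6 < m ->
  exists2 h : {ffun 'I_p.*2.+3 -> 'I_m}, injective h & violates (codom (f \o h)).
Proof.
move=> lt; have := @shift_run3 m p.*2 'I_3 (fun s => window_color (map f s)).
rewrite card_ord => /(_ lt) [s /andP[ss /eqP sz] [e1 e2]].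
have m0 : 'I_m by apply: (@Ordinal _ 0); lia.
pose h := [ffun i : 'I_p.*2.+3 => nth m0 s i].
have he : codom h = s.
  apply: (@eq_from_nth _ m0); first by rewrite size_codom card_ord sz.
  move=> i; rewrite size_codom card_ord => ir.
  rewrite codomE (nth_map (Ordinal ir)) ?size_enum_ord //.
  by rewrite -[i]/(val (Ordinal ir)) nth_ord_enum ffunE.
have us : uniq s.
  by apply: sorted_uniq ss => [x y z|x]; [apply: ltn_trans | apply: ltnn].
exists h.
  by move=> i j /eqP; rewrite !ffunE nth_uniq ?sz // => /eqP /val_inj.
have -> : codom (f \o h) = map f s by rewrite -he !codomE -map_comp.
have beh (T : Type) (r : seq T) : behead r = drop 1 r by case: r => //= x r; rewrite drop0.
rewrite /violates -!map_drop -!map_take; apply/andP; split.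
  by rewrite e1 beh.
rewrite -(beh _ s) e2 !beh drop_drop take_oversize //.
by rewrite size_drop sz; lia.
Qed.

Definition violators : pred {ffun 'I_p.*2.+3 -> 'I_n} := fun w => violates (codom w).

(** Double counting: among [m] random labels some injective choice of [2p + 3] is violating, each
    such choice is a uniform block, and there are at most [m ^ (2p + 3)] of them. *)
Lemma card_violators m : tower p.*2.+1 6 < m ->
  n ^ p.*2.+3 <= #|violators| * m ^ p.*2.+3.
Proof.
move=> lt.
have n0 : 0 < n by case: (n) x0 => // -[].
pose Inj := [pred h : {ffun 'I_p.*2.+3 -> 'I_m} | injectiveb h].
have H : #|{ffun 'I_m -> 'I_n}| <=
    \sum_(h in Inj) #|[pred f : {ffun 'I_m -> 'I_n} | violators (pullback h f)]|.
  have -> : \sum_(h in Inj) #|[pred f : {ffun 'I_m -> 'I_n} | violators (pullback h f)]| =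
      \sum_(f : {ffun 'I_m -> 'I_n}) \sum_(h in Inj) (violators (pullback h f) : nat).
    rewrite [RHS]exchange_big; apply: eq_bigr => h _.
    by rewrite -sum1_card big_mkcond /=; apply: eq_bigr => f _; rewrite !inE; case: (violators _).
  rewrite -sum1_card; apply: leq_sum => f _.
  have [h hi hv] := violates_exists f lt.
  rewrite (bigD1 h) /=; last by rewrite inE; apply/injectiveP.
  suff -> : violators (pullback h f) by lia.
  rewrite /violators.
  by rewrite (_ : codom _ = codom (f \o h)) // !codomE; apply: eq_map => i; rewrite ffunE.
have {}H : #|{ffun 'I_m -> 'I_n}| * #|{ffun 'I_p.*2.+3 -> 'I_n}| <=
    #|Inj| * (#|violators| * #|{ffun 'I_m -> 'I_n}|).
  apply: leq_trans (leq_mul H (leqnn _)) _.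
  rewrite big_distrl -sum_nat_const; apply: leq_sum => h /injectiveP hi.
  exact/eq_leq/(card_pullback hi).
rewrite -(@leq_pmul2l #|{ffun 'I_m -> 'I_n}|); last first.
  by rewrite card_ffun !card_ord expn_gt0 n0.
rewrite !card_ffun !card_ord in H *.
have le : #|Inj| <= m ^ p.*2.+3.
  by apply: leq_trans (max_card _) _; rewrite card_ffun !card_ord.
apply: (leq_trans H); apply: (leq_trans (leq_mul le (leqnn _))).
by apply/eq_leq; ring.
Qed.
End Violation.

(** * Many independent blocks *)

Section Blocks.
Variables (n N p L : nat) (x0 : 'I_n) (A : lca 3).
Local Notation K := p.*2.+3.
Implicit Type (c : {ffun 'I_(L * K) -> 'I_n}).

Definition block c (j : nat) : {ffun 'I_K -> 'I_n} := [ffun e : 'I_K => label x0 c (j * K + e)].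

Lemma codom_block c (j : 'I_L) : codom (block c j) = take K (drop (j * K) (codom c)).
Proof.
have jK : j * K + K <= L * K by rewrite addnC -mulSn leq_mul2r ltn_ord orbT.
apply: (@eq_from_nth _ x0).
  rewrite size_codom size_takel ?card_ord // size_drop size_codom card_ord; lia.
move=> i; rewrite size_codom card_ord => iK.
rewrite nth_take // nth_drop codomE (nth_map (Ordinal iK)) ?size_enum_ord //.
by rewrite -[i in nth _ _ i]/(val (Ordinal iK)) nth_ord_enum ffunE.
Qed.

(** Independence: a configuration is determined by its [L] disjoint blocks, each of which has to
    avoid the violators. *)
Lemma card_no_violation :
  #|[pred c | [forall j : 'I_L, ~~ violators x0 A (block c j)]]| <=
    (n ^ K - #|violators (p := p) x0 A|) ^ L.
Proof.
pose B c : {ffun 'I_L -> {ffun 'I_K -> 'I_n}} := [ffun j : 'I_L => block c j].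
have B_inj : injective B.
  move=> c c' /ffunP e; apply/ffunP => i.
  have jL : i %/ K < L by rewrite ltn_divLR.
  have eK : i %% K < K by rewrite ltn_pmod.
  have := e (Ordinal jL); rewrite !ffunE => /ffunP /(_ (Ordinal eK)).
  by rewrite !ffunE /= -divn_eq !labelE.
rewrite -(fintype.card_image B_inj).
have -> : n ^ K - #|violators (p := p) x0 A| = #|[predC (violators (p := p) x0 A)]|.
  have := cardC (violators (p := p) x0 A); rewrite card_ffun !card_ord => <-.
  by rewrite addKn.
have := @card_ffun_on 'I_L _ [predC (violators (p := p) x0 A)].
rewrite card_ord => <-.
apply/subset_leq_card/fintype.subsetP => g /fintype.imageP[c]; rewrite inE => /forallP H ->.
by apply/ffun_onP => j; rewrite ffunE !inE; apply: H.
Qed.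

Variables (c : {ffun 'I_(L * K) -> 'I_n}) (G : id_graph n N).

(** With at most [p] probes per query, the simulated colors are the actual answers, so a violation
    would break the weak coloring at the middle vertex of the block, at position [j * K + 1 + p]. *)
Lemma few_probes_no_violation :
  1 < n -> is_cycle_graph G -> splices (codom c) G -> good p x0 A c ->
  weak_colors_cycles n N A -> (forall v, query_probes A G v <= p) ->
  forall j : 'I_L, ~~ violators x0 A (block c j).
Proof.
move=> n1 Gc spl gd wc few j; apply/negP.
have jK : j * K + K <= L * K by rewrite addnC -mulSn leq_mul2r ltn_ord orbT.
have win e : e <= 2 -> window_color p x0 A (take p.*2.+1 (drop e (codom (block c j)))) =
    answer A G (label x0 c (j * K + e + p)).
  move=> e2; rewrite codom_block take_drop take_takel -?take_drop; last lia.
  rewrite drop_drop /window_color.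
  have bM : j * K + e + p.*2 < L * K by lia.
  have := good_answer n1 spl gd bM (few _); rewrite /sight => ->.
  apply: sim_color_ext => d dp.
  by rewrite nth_take // nth_drop /sight /label; congr nth; lia.
rewrite /violators /violates -{1}[codom _]drop0 !win // => /andP[/eqP e1 /eqP e2].
have [_ lG _] := spl.
have adjE := lG x0 (j * K + 1 + p) (ltac:(lia)) _.
rewrite size_codom card_ord in adjE; have {}adjE := adjE (ltac:(lia)).
have := wc G Gc (label x0 c (j * K + 1 + p)); case.
  exists (label x0 c (j * K + 1 + p).+1); rewrite -[adj _ _ _]/(_ \in adj G _).
  by rewrite adjE mem_head.
move=> u; rewrite -[adj _ _ _]/(_ \in adj G _) adjE !inE => /orP[]/eqP -> ne; apply: ne.
  rewrite e2 -/(label x0 c _); congr (answer _ _ (label _ _ _)); lia.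
rewrite -e1 -/(label x0 c _); congr (answer _ _ (label _ _ _)); lia.
Qed.
End Blocks.

(** * Amplification by a Bernoulli inequality *)

Lemma bernoulli_nat R L : 0 < R -> R.-1 ^ L * (R + L) <= R ^ L * R.
Proof.
case: R => // R _; elim: L => [|L IH]; first by rewrite addn0.
rewrite !expnS /=.
apply: (@leq_trans (R.+1 * (R ^ L * (R.+1 + L)))); last by rewrite -!mulnA leq_mul2l.
rewrite -mulnA [R * _]mulnCA [R.+1 * _]mulnCA leq_mul2l; apply/orP; right; nia.
Qed.

(** [L] independent trials of success probability [V / X >= 1 / R] all fail with probability at most
    [R / (R + L)]. *)
Lemma power_avoid X V R L : 0 < R -> V <= X -> X <= V * R ->
  (X - V) ^ L * (R + L) <= X ^ L * R.
Proof.
move=> R0 VX XVR.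
have H : (X - V) * R <= X * R.-1 by case: R R0 XVR => // R _ XVR /=; nia.
rewrite -(@leq_pmul2l (R ^ L)) ?expn_gt0 ?R0 // mulnA -expnMn [R * _]mulnC.
apply: (@leq_trans ((X * R.-1) ^ L * (R + L))).
  by rewrite leq_mul2r; apply/orP; right; case: L => // L; rewrite leq_exp2r.
by rewrite expnMn -mulnA [X in _ <= X]mulnCA leq_mul2l bernoulli_nat ?orbT.
Qed.

(** With [2D * R] blocks, at most a fraction [1 / (2D + 1)] of the configurations has no violation,
    and the bound on [n] makes at most [1 / (2D)] of them not good: less than [1 / D] in total. The
    family [G] is chosen before [A], so that it can serve all seeds at once. *)
Lemma few_probes_rare (n N p m D : nat) :
  let R := m ^ p.*2.+3 in let M := D.*2 * R * p.*2.+3 in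
  3 <= n -> n <= N -> tower p.*2.+1 6 < m -> 0 < D -> 10 * D * (M * M * p.+1) <= n ->
  exists (C : finType) (G : C -> id_graph n N),
    (forall c, is_cycle_graph (G c)) /\
    forall A : lca 3, weak_colors_cycles n N A ->
      #|[pred c | [forall v, query_probes A (G c) v <= p]]| * D < #|C|.
Proof.
move=> R M n3 nN mt D0 nM; pose L := D.*2 * R.
have x0 : 'I_n by apply: (@Ordinal _ 0); lia.
have R0 : 0 < R by rewrite expn_gt0; lia.
have L0 : 0 < L by rewrite /L muln_gt0 R0 double_gt0 D0.
have M0 : 0 < M by rewrite /M muln_gt0 -/L L0.
have ex (c : {ffun 'I_(L * p.*2.+3) -> 'I_n}) : exists G : id_graph n N,
    is_cycle_graph G /\ (uniq (codom c) -> splices (codom c) G).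
  have [u|nu] := boolP (uniq (codom c)).
    have [|G Gc spl] := spliced_cycle nN n3 u; first by rewrite size_codom card_ord.
    by exists G.
  (* Any cycle will do for a configuration with a repeated label, since it is not good. *)
  have [G Gc _] := @spliced_cycle n N [:: x0] nN n3 isT isT.
  by exists G; split => // u; rewrite u in nu.
have [G HG] := boolp.choice ex.
exists {ffun 'I_(L * p.*2.+3) -> 'I_n}, G; split => [c|A wc]; first by have [] := HG c.
pose bad := [pred c : {ffun 'I_(L * p.*2.+3) -> 'I_n} | ~~ good p x0 A c].
pose nv := [pred c : {ffun 'I_(L * p.*2.+3) -> 'I_n} |
  [forall j : 'I_L, ~~ violators x0 A (block x0 c j)]].
have le : #|[pred c | [forall v, query_probes A (G c) v <= p]]| <= #|bad| + #|nv|.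
  rewrite -cardUI; apply: leq_trans (leq_addr _ _).
  apply/subset_leq_card/fintype.subsetP => c; rewrite !inE => /forallP few.
  have [gd|ng] := boolP (good p x0 A c); last by [].
  apply/orP; right; apply/forallP => j.
  have [Gc spl] := HG c; apply: (few_probes_no_violation _ Gc _ gd wc few j); first lia.
  by apply: spl; apply/injectiveP/good_inj/gd.
have Eb := @card_not_good n p (L * p.*2.+3) x0 A; rewrite -/bad in Eb.
have En := @card_no_violation n p L x0 A; rewrite -/nv in En.
have Vle : #|violators (p := p) x0 A| <= n ^ p.*2.+3.
  by apply: leq_trans (max_card _) _; rewrite card_ffun !card_ord.
have Ep := power_avoid L R0 Vle (card_violators x0 A mt).
rewrite card_ffun !card_ord.
have XE : n ^ (L * p.*2.+3) = (n ^ p.*2.+3) ^ L by rewrite mulnC expnM.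
rewrite XE in Eb *; set X := (n ^ p.*2.+3) ^ L in Eb Ep *.
have X0 : 0 < X by rewrite !expn_gt0; lia.
have En2 : #|nv| * D.*2.+1 <= X.
  have := leq_trans (leq_mul En (leqnn (R + L))) Ep.
  by rewrite -{1}[R]mul1n /L -mulnDl add1n mulnA leq_pmul2r.
have Eb2 : #|bad| * D.*2 <= X.
  have Q0 : 0 < 5 * (M * M * p.+1) by move: (M) M0 => M' M0'; rewrite !muln_gt0 M0'.
  rewrite -(leq_pmul2l Q0).
  apply: leq_trans Eb; apply: leq_trans (leq_mul (leqnn #|bad|) nM).
  by apply/eq_leq; rewrite -(muln2 D); move: #|bad| (M * M * p.+1) => y z; ring.
move: le En2 Eb2 X0; move: #|_| #|bad| #|nv| => x y z; clear; nia.
Qed.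

(** * Estimates on towers *)

Lemma leq_tower_base k c c' : c <= c' -> tower k c <= tower k c'.
Proof. by move=> cc'; elim: k => //= k IH; rewrite leq_exp2l. Qed.

Lemma towerD k l c : tower (k + l) c = tower k (tower l c).
Proof. exact: iterD. Qed.

Lemma ltn_tower k : k < tower k 1.
Proof. by elim: k => //= k IH; apply: leq_ltn_trans IH (ltn_expl _ _). Qed.

Lemma tower_mono k l : k <= l -> tower k 1 <= tower l 1.
Proof.
move=> /subnKC <-; rewrite towerD leq_tower_base //.
by case: (l - k) => // j; apply: leq_trans (ltn_tower _).
Qed.

Lemma towerS k c : tower k.+1 c = 2 ^ tower k c. Proof. by []. Qed.

Lemma triple_leq_exp2 x : 4 <= x -> 3 * x <= 2 ^ x.
Proof.
elim: x => // x IH; rewrite leq_eqVlt => /orP[/eqP <- //|x4].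
by rewrite expnS; have := IH x4; lia.
Qed.

(** All quantities are compared with [X = tower (2p + D + 5) 1]: the left side is at most
    [X ^ (2X + 8)], hence at most [2 ^ (X ^ 3)], and three exponentials above [X] exceed this. *)
Lemma tower_dominates p D :
  let m := (tower p.*2.+1 6).+1 in let M := D.*2 * m ^ p.*2.+3 * p.*2.+3 in
  0 < D -> 10 * D * (M * M * p.+1) <= tower (p.*2 + D + 8) 1.
Proof.
move=> m M D0.
have [X XE] : exists X, X = tower (p.*2 + D + 5) 1 by eexists.
have kX : p.*2 + D + 5 < X by rewrite XE ltn_tower.
have mX : m <= X.
  apply: (@leq_ltn_trans (tower (p.*2 + D + 4) 1)).
    (* The base 6 is absorbed by [tower 3 1 = 16]. *)
    apply: (@leq_trans (tower (p.*2.+1 + 3) 1)); last by apply: tower_mono; lia.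
    by rewrite towerD leq_tower_base.
  by rewrite XE [_ + 5]addnS towerS ltn_expl.
have -> : tower (p.*2 + D + 8) 1 = 2 ^ (2 ^ (2 ^ X)).
  by rewrite XE -[p.*2 + D + 8]/(p.*2 + D + (3 + 5)) addnCA towerD.
clear XE.
have RX : m ^ p.*2.+3 <= X ^ X.
  apply: (@leq_trans (X ^ p.*2.+3)); first by rewrite leq_exp2r.
  by rewrite leq_pexp2l; lia.
have MX : M <= X * X * X ^ X * 2.
  rewrite /M; move: RX; move: (m ^ _) (X ^ X) => r rr rle.
  apply: (@leq_trans (X.*2 * rr * X)); last by apply/eq_leq; rewrite -muln2; ring.
  by rewrite !leq_mul ?leq_double //; lia.
clearbody M.
have X6 : 6 < X by lia.
apply: (@leq_trans (X * X * (X ^ X * X ^ X * X ^ 6))).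
  apply: (@leq_trans (10 * X * ((X * X * X ^ X * 2) * (X * X * X ^ X * 2) * X))).
    by rewrite !leq_mul //; lia.
  have X16 : 40 <= X * X by move: X6; clear; nia.
  move: (X ^ X) => r.
  apply: (@leq_trans (40 * (r * r * X ^ 6))); first by apply/eq_leq; ring.
  by rewrite leq_mul2r X16 orbT.
have -> : X * X * (X ^ X * X ^ X * X ^ 6) = X ^ (X + X + 8).
  by rewrite !expnD; move: (X ^ X) => r; ring.
apply: (@leq_trans ((2 ^ X) ^ (X * X))).
  apply: (@leq_trans (X ^ (X * X))); first by rewrite leq_pexp2l //; move: X6; clear; nia.
  by rewrite leq_exp2r; [apply/ltnW/ltn_expl | rewrite muln_gt0; lia].
rewrite -expnM leq_exp2l //.
apply: (@leq_trans (2 ^ X * (2 ^ X * 2 ^ X))).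
  by rewrite !leq_mul // ltnW // ltn_expl.
by rewrite -!expnD leq_exp2l //; have := @triple_leq_exp2 X; lia.
Qed.

(** * Towers against the iterated logarithm *)

Section LogStarBounds.
Variable R : realType.
Import Order.TTheory GRing.Theory Num.Theory.
Local Open Scope ring_scope.

Lemma iter_log2_gt1 k (x : R) : (tower k 1)%:R < x -> 1 < iter k (@log2 R) x.
Proof.
have l2 : 0 < ln (2 : R) by rewrite ln_gt0// ltr1n.
elim: k x => [//|k IH] x; rewrite towerS iterSr => lt; apply: IH.
have x0 : 0 < x by apply: le_lt_trans lt; rewrite ler0n.
rewrite /log2 ltr_pdivlMr // mulr_natl -lnXn ?ltr0n // ltr_ln ?posrE ?exprn_gt0 //.
by rewrite -natrX.
Qed.

Lemma log_star_gt k n : (tower k 1 < n)%N -> (k < log_star R n)%N.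
Proof.
move=> lt; rewrite /log_star; case: ex_minnP => j jle _; rewrite ltnNge; apply/negP => jk.
have : 1 < iter j (@log2 R) n%:R.
  by apply: iter_log2_gt1; rewrite ltr_nat; apply: leq_ltn_trans lt; apply: tower_mono.
by rewrite ltNge jle.
Qed.

Lemma log_star_gtP k n : (k < log_star R n)%N -> (tower k 1 < n)%N.
Proof.
rewrite /log_star; case: ex_minnP => j _ jmin kj; rewrite ltnNge; apply/negP => nk.
move: kj; rewrite ltnNge jmin //; apply: iter_log2_le1.
by rewrite ler_nat.
Qed.
End LogStarBounds.

(** * Averaging over the seed *)

Section Averaging.
Import Order.TTheory GRing.Theory Num.Theory.
Local Open Scope classical_set_scope.
Local Open Scope ring_scope.

(** Otherwise every seed succeeds on fewer than [#|C| / D] inputs, hence so does the average seed,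
    while each input succeeds with probability at least [1 - delta >= 1 / D]. *)
Lemma exists_rarely_failing_seed (R : realType) (d : measure_display) (T : measurableType d)
    (P : probability T R) (C : finType) (F : C -> set T) (delta : R) (D : nat) :
  1 <= D%:R * (1 - delta) ->
  (forall c, measurable (F c) /\ (P (F c) <= delta%:E)%E) ->
  exists s, (#|C| <= #|[pred c | `[< ~ F c s >]]| * D)%N.
Proof.
move=> Dd HF; apply: contrapT => /forallNP H.
have {}H s : (#|[pred c | `[< ~ F c s >]]| * D < #|C|)%N.
  by rewrite ltnNge; apply/negP/H.
have D0 : 0 < D%:R :> R.
  rewrite ltr0n lt0n; apply/eqP => D0; move: Dd; rewrite D0 mul0r; lra.
have [s0] : exists s : T, True.
  apply: contrapT => /forallNP nT.
  have : P setT = P set0 by congr (P _); apply/seteqP; split => // x; case: (nT x).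
  by rewrite probability_setT measure0 => /eqP; rewrite eqe oner_eq0.
move=> _; have C0 : (0 < #|C|)%N by apply: leq_ltn_trans (H s0).
have mC c : measurable (~` F c) by apply: measurableC; have [] := HF c.
(* Counts being integers, the strict bound on them becomes a bound by [r]; the predecessor keeps the
   strictness through integration. *)
pose r : R := (#|C|.-1)%:R / D%:R.
have mf c : measurable_fun setT (EFin \o (\1_(~` F c) : T -> R)).
  by apply/measurable_EFinP; apply: measurable_realfun.measurable_indic.
have f0 c (x : T) : setT x -> (0 <= (\1_(~` F c) x)%:E :> \bar R)%E.
  by move=> _; rewrite lee_fin indicE ler0n.
have le1 : (\sum_(c <- index_enum C) P (~` F c) <= r%:E)%E.
  have -> : (\sum_(c <- index_enum C) P (~` F c) =
      \int[P]_(x in setT) (\sum_(c <- index_enum C) (\1_(~` F c) x)%:E))%E.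
    rewrite ge0_integral_sum //; apply: eq_bigr => c _.
    by rewrite integral_indic // setIT.
  rewrite -[leRHS](_ : (\int[P]_(x in setT) cst r%:E x)%E = _); last first.
    by rewrite integral_cst // [X in (_ * X)%E]probability_setT mule1.
  apply: ge0_le_integral => //.
  - by move=> x _; apply: sume_ge0 => c _; apply: f0.
  - exact: emeasurable_sum.
  move=> x _; rewrite sumEFin lee_fin /r ler_pdivlMr //.
  have -> : \sum_(c <- index_enum C) \1_(~` F c) x = #|[pred c | `[< ~ F c x >]]|%:R :> R.
    rewrite -sum1_card natr_sum [RHS]big_mkcond /=; apply: eq_bigr => c _.
    by rewrite indicE unfold_in /=; case: asboolP => h; [rewrite mem_set | rewrite memNset].
  by rewrite -natrM ler_nat; have := H x; lia.
have : (\sum_(c <- index_enum C) (1 - delta)%:E <= r%:E)%E.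
  apply: le_trans le1; apply: lee_sum => c _.
  have [mF PF] := HF c; rewrite probability_setC // EFinB.
  by apply: leeB.
rewrite sumEFin lee_fin sumr_const -mulr_natl /r ler_pdivlMr //.
rewrite -mulrA [_ * D%:R]mulrC => h.
have : #|C|%:R <= (#|C|.-1)%:R :> R by apply: le_trans h; rewrite ler_peMr.
by rewrite ler_nat; lia.
Qed.
End Averaging.

(** Both [4p] and [2D + 20] are below [log_star R n], hence so is their mean [2p + D + 10], which
    gives the height required by [tower_dominates]. *)
Lemma few_probes_rare_log_star (R : realType) (n N p D : nat) :
  n <= N -> 0 < D -> tower (D.*2 + 20) 1 < n -> 4 * p < log_star R n ->
  exists (C : finType) (G : C -> id_graph n N),
    (forall c, is_cycle_graph (G c)) /\
    forall A : lca 3, weak_colors_cycles n N A ->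
      #|[pred c | [forall v, query_probes A (G c) v <= p]]| * D < #|C|.
Proof.
move=> nN D0 nlarge pl; have ls := log_star_gt R nlarge.
have nT : tower (p.*2 + D + 8) 1 < n by apply: (@log_star_gtP R); lia.
apply: (few_probes_rare _ nN (ltnSn _) D0 _).
  by have := ltn_tower (p.*2 + D + 8); lia.
exact: leq_trans (tower_dominates p D0) (ltnW nT).
Qed.

Import Order.TTheory GRing.Theory Num.Theory.
Import numFieldNormedType.Exports.

Local Open Scope classical_set_scope.
Local Open Scope ring_scope.

Theorem theorem2 (R : realType) (N : nat -> nat) (hN : forall n, (n <= N n)%N) :
  (forall (p : nat -> nat) (A : nat -> lca 3),
     (forall n, (3 <= n)%N ->
        weak_colors_cycles n (N n) (A n) /\ uses_probes n (N n) (A n) (p n)) ->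
     exists2 C : R, 0 < C &
       \forall n \near \oo, C * (log_star R n)%:R <= (p n)%:R)
  /\
  (forall (d : nat -> measure_display) (T : forall n, measurableType (d n))
      (P : forall n, probability (T n) R) (p : nat -> nat) (delta : nat -> R)
      (A : forall n, T n -> lca 3),
     (exists2 delta0 : R, delta0 < 1 &
        forall n, (3 <= n)%N -> delta n <= delta0) ->
     (forall n, (3 <= n)%N ->
        (forall s, weak_colors_cycles n (N n) (A n s)) /\
        uses_probes_with_failure n (N n) (P n) (A n) (p n) (delta n)) ->
     exists2 C : R, 0 < C &
       \forall n \near \oo, C * (log_star R n)%:R <= (p n)%:R).
Proof.
have probes_lt (n q : nat) : ~ (4^-1 * (log_star R n)%:R <= q%:R :> R) ->
    (4 * q < log_star R n)%N.
  move=> /negP; rewrite -ltNge => lt; rewrite -(ltr_nat R) natrM.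
  by rewrite -ltr_pdivlMl ?ltr0n.
have large (D n : nat) : (tower (D.*2 + 20) 1 < n)%N -> (3 <= n)%N.
  by have := ltn_tower (D.*2 + 20); lia.
split=> [p A HA|d T P p delta A [delta0 d1 Hd] HA]; exists 4^-1; rewrite ?invr_gt0 ?ltr0n //.
  near=> n; apply: contrapT => /probes_lt few.
  have nlarge : (tower (1.*2 + 20) 1 < n)%N by near: n; apply: nbhs_infty_gt.
  have [C [G [Gc rare]]] := few_probes_rare_log_star (hN n) (ltn0Sn 0) nlarge few.
  have [wc up] := HA n (large _ _ nlarge).
  (* With [D = 1], [rare] says that some cycle of the family needs more than [p n] probes, against
     [up]. *)
  have := rare _ wc; rewrite muln1 eq_cardT ?cardT ?ltnn // => c.
  by apply/forallP => v; apply: up.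
(* [D] depends on [delta0] alone and satisfies [1 / D <= 1 - delta0]: some seed then succeeds on at
   least a fraction [1 / D] of the family, against [rare]. *)
pose D := (Num.trunc (1 - delta0)^-1).+1.
have D1 : 1 <= D%:R * (1 - delta0).
  have d0 : 0 < 1 - delta0 by rewrite subr_gt0.
  by rewrite -ler_pdivrMr // mul1r ltW // truncnS_gt.
near=> n; apply: contrapT => /probes_lt few.
have nlarge : (tower (D.*2 + 20) 1 < n)%N by near: n; apply: nbhs_infty_gt.
have n3 := large _ _ nlarge.
have [C [G [Gc rare]]] := few_probes_rare_log_star (hN n) (ltn0Sn _) nlarge few.
have [wc up] := HA n n3.
have [c|s] := @exists_rarely_failing_seed R _ _ (P n) C
  (fun c => [set s | exists v, (p n < query_probes (A n s) (G c) v)%N]) delta0 D D1.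
  have [mF PF] := up (G c) (Gc c); split=> //.
  by apply: le_trans PF _; rewrite lee_fin Hd.
apply/negP; rewrite -ltnNge; apply: leq_ltn_trans (rare _ (wc s)).
rewrite leq_mul2r; apply/orP; right; apply/subset_leq_card/fintype.subsetP => c.
rewrite !unfold_in /= => /asboolP notF; apply/forallP => v; rewrite leqNgt.
by apply/negP => lt; apply: notF; exists v.
Unshelve. all: by end_near.
Qed.
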